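(* In the discretized random walk in an equilateral triangle $ABC$ described in the context, let the game state be $P = xA+yB+zC$, where $(x,y,z)$ are the barycentric coordinates of the tiling vertex $P$ (so $x,y,z\in[0,1]$ and $x+y+z=1$). Then the game evaluation at $P$ is $$(P_A,P_B,P_C) = (x,y,z).$$
   Context: Let $ABC$ be an equilateral triangle, tiled by congruent small equilateral triangles obtained by subdividing each edge into $n$ equal parts ($n\ge 1$ an integer). The possible game states are the vertices of the tiling, i.e. the points $\frac{a}{n}A+\frac{b}{n}B+\frac{c}{n}C$ with $a,b,c$ nonnegative integers and $a+b+c=n$. The game state moves as follows at each discrete time step: from a tiling vertex in the interior of the triangle it moves to one of the six adjacent tiling vertices, each with probability $1/6$; from a tiling vertex on an edge of the triangle other than $A,B,C$ it moves to one of the two adjacent tiling vertices along that edge, each with probability $1/2$ (so once an edge is reached the walk stays on it); steps are independent. The walk stops upon reaching one of $A,B,C$. The game evaluation at $P$ is the triple $(P_A,P_B,P_C)$, where $P_A$ (respectively $P_B$, $P_C$) is the probability that the walk started at $P$ reaches $A$ (respectively $B$, $C$) before any other vertex of the triangle $ABC$. *)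

(* Defs.v *)
From HB Require Import structures.
From mathcomp Require Export all_boot all_order all_algebra.
From mathcomp Require Export all_classical all_reals all_analysis.

Set Implicit Arguments.
Unset Strict Implicit.
Unset Printing Implicit Defensive.

Import Order.TTheory GRing.Theory Num.Theory.
Local Open Scope classical_set_scope.
Local Open Scope ring_scope.

(* The library norm on 'rV[R]_2 is the sup norm, hence this definition. *)
Definition edist (R : realType) (p q : 'rV[R]_2) : R :=
  Num.sqrt (\sum_(i < 2) (p 0 i - q 0 i) ^+ 2).

Definition equilateral (R : realType) (A B C : 'rV[R]_2) : Prop :=
  [/\ A <> B, edist A B = edist B C & edist B C = edist C A].

Definition barycentric (R : realType) (A B C p : 'rV[R]_2) (x y z : R) : Prop :=
  x + y + z = 1 /\ p = x *: A + y *: B + z *: C.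

(* The triple (a, b, c) stands for the tiling vertex (a/n)A + (b/n)B + (c/n)C,
   see [pos]. *)
Definition tvertex (n : nat) : finType :=
  {v : 'I_n.+1 * 'I_n.+1 * 'I_n.+1 | (v.1.1 + v.1.2 + v.2 == n)%N}.

Section Tiling.
Variable n : nat.
Implicit Types v w : tvertex n.

Definition ca v : nat := (val v).1.1.
Definition cb v : nat := (val v).1.2.
Definition cc v : nat := (val v).2.

Definition pos (R : realType) (A B C : 'rV[R]_2) v : 'rV[R]_2 :=
  ((ca v)%:R / n%:R) *: A + ((cb v)%:R / n%:R) *: B + ((cc v)%:R / n%:R) *: C.

Fact cornerA_subproof : ((@ord_max n) + (@ord0 n) + (@ord0 n) == n)%N.
Proof. by rewrite /= !addn0. Qed.
Fact cornerB_subproof : ((@ord0 n) + (@ord_max n) + (@ord0 n) == n)%N.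
Proof. by rewrite /= addn0. Qed.
Fact cornerC_subproof : ((@ord0 n) + (@ord0 n) + (@ord_max n) == n)%N.
Proof. by []. Qed.

Definition cornerA : tvertex n := exist _ (ord_max, ord0, ord0) cornerA_subproof.
Definition cornerB : tvertex n := exist _ (ord0, ord_max, ord0) cornerB_subproof.
Definition cornerC : tvertex n := exist _ (ord0, ord0, ord_max) cornerC_subproof.

Definition corner v : bool := v \in [:: cornerA; cornerB; cornerC].

Definition interior_vertex v : bool :=
  [&& (0 < ca v)%N, (0 < cb v)%N & (0 < cc v)%N].

(* The sides of the small triangles are the translates of (A - B)/n, (B - C)/n
   and (C - A)/n. *)
Definition adjacent v w : bool :=
  ((ca w)%:Z - (ca v)%:Z, (cb w)%:Z - (cb v)%:Z, (cc w)%:Z - (cc v)%:Z)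
    \in [:: (1, -1, 0); (-1, 1, 0); (0, 1, -1); (0, -1, 1); (-1, 0, 1); (1, 0, -1)].

Definition same_edge v w : bool :=
  [|| (ca v == 0%N) && (ca w == 0%N),
      (cb v == 0%N) && (cb w == 0%N)
    | (cc v == 0%N) && (cc w == 0%N)].

(* Probability of moving from v to w in one step; the stopped walk is encoded by
   making the corners absorbing. *)
Definition step (R : realType) v w : R :=
  if corner v then (w == v)%:R
  else if interior_vertex v then (adjacent v w)%:R / 6
  else (adjacent v w && same_edge v w)%:R / 2.

(* X is the walk started at p: a Markov chain with transition probabilities
   [step].  The third clause is the Markov property
     P(X_{t+1} = x_{t+1} | X_0 = x_0, ..., X_t = x_t) = step x_t x_{t+1},
   multiplied out so that histories of probability 0 need no special case. *)
Definition is_walk d (T : measurableType d) (R : realType) (Pr : probability T R)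
    (X : nat -> T -> tvertex n) (p : tvertex n) : Prop :=
  [/\ forall t v, measurable [set om | X t om = v],
      Pr [set om | X 0%N om = p] = 1%E
    & forall (t : nat) (x : nat -> tvertex n),
        Pr [set om | forall s, (s <= t.+1)%N -> X s om = x s] =
        (Pr [set om | forall s, (s <= t)%N -> X s om = x s]
          * (step R (x t) (x t.+1))%:E)%E].

Definition reaches_first (T : Type) (X : nat -> T -> tvertex n) (k : tvertex n) :
    set T :=
  [set om | exists t, X t om = k /\
     forall s, (s < t)%N -> corner (X s om) -> X s om = k].

Definition game_evaluation d (T : measurableType d) (R : realType)
    (Pr : probability T R) (X : nat -> T -> tvertex n) : \bar R * \bar R * \bar R :=
  (Pr (reaches_first X cornerA), Pr (reaches_first X cornerB),
   Pr (reaches_first X cornerC)).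

End Tiling.

(* Main.v *)
Require Import Defs.
From mathcomp Require Import zify ring lra.

Set Implicit Arguments.
Unset Strict Implicit.
Unset Printing Implicit Defensive.

Import Order.TTheory GRing.Theory Num.Theory.
Local Open Scope classical_set_scope.
Local Open Scope ring_scope.

(** The three barycentric coordinates are martingales of the walk: the possible
    displacements from a vertex that is not a corner come in opposite pairs of
    equal probability.  At a corner one coordinate is [n] and the others vanish,
    so once the walk is absorbed, the mean of a coordinate divided by [n] is the
    probability of sitting at the corresponding corner; that mean is the value at
    the starting point.

    Absorption is controlled by a second moment.  Every displacement has squared
    length [2] in the coordinates [(a, b, c)], so the mean of [a^2 + b^2 + c^2]
    grows by twice the probability [alive t] that the walk is not yet absorbed
    ([mean_moments]).  As this quantity never exceeds [n^2], the sum of the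
    [alive t] is bounded and [alive t] takes arbitrarily small values
    ([absorption]).

    No limit is taken.  Up to a null event, being at a corner [k] at time [t]
    implies that [k] is the first corner reached ([law_le_reach]), because corners
    are absorbing.  Hence the probability of reaching [k] first is at least the
    barycentric coordinate of the starting point at [k] ([reach_ge]).  The three
    events are disjoint and the three lower bounds add up to [1], so the bounds
    are equalities ([reach_probabilities]).

    It remains to identify the given barycentric coordinates with those of the
    vertex, that is, to see that the vertices of an equilateral triangle are
    affinely independent ([equilateral_barycentric_unique]). *)

(** * One step of the walk *)

Section Step.
Context (R : realType) (n : nat).
Implicit Types v w : tvertex n.

Lemma coord_sum v : (ca v + cb v + cc v = n)%N.
Proof. by apply/eqP; exact: (valP v). Qed.

Lemma tvertexE v w : (v == w) = [&& ca v == ca w, cb v == cb w & cc v == cc w].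
Proof.
rewrite -val_eqE /ca /cb /cc; case: (val v) (val w) => [[a b] c] [[a' b'] c'].
by rewrite !xpair_eqE andbA.
Qed.

Lemma tvertex_of_coords (a b c : nat) : (a + b + c = n)%N ->
  exists v, [/\ ca v = a, cb v = b & cc v = c].
Proof.
move=> e.
have [la lb lc] : [/\ a < n.+1, b < n.+1 & c < n.+1]%N by split; lia.
have p : (Ordinal la + Ordinal lb + Ordinal lc == n)%N by apply/eqP.
by exists (exist _ (Ordinal la, Ordinal lb, Ordinal lc) p).
Qed.

Lemma corner_coords v : corner v = [|| ca v == n, cb v == n | cc v == n].
Proof.
rewrite /corner !inE !tvertexE.
have -> : ca (cornerA n) = n by []. have -> : cb (cornerA n) = 0%N by [].
have -> : cc (cornerA n) = 0%N by [].
have -> : ca (cornerB n) = 0%N by []. have -> : cb (cornerB n) = n by [].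
have -> : cc (cornerB n) = 0%N by [].
have -> : ca (cornerC n) = 0%N by []. have -> : cb (cornerC n) = 0%N by [].
have -> : cc (cornerC n) = n by [].
have := coord_sum v; lia.
Qed.

Lemma step_sum_uniform v (k : R) (s : seq (tvertex n)) (f : tvertex n -> R) :
  uniq s -> (forall w, step R v w = (w \in s)%:R / k) ->
  \sum_w step R v w * f w = (\sum_(w <- s) f w) / k.
Proof.
move=> us es; rewrite [in RHS](big_uniq _ us) /= mulr_suml [RHS]big_mkcond /=.
apply: eq_bigr => w _; rewrite es.
by case: (w \in s); rewrite ?mul0r // mul1r mulrC.
Qed.

(** Successors instead of signed differences: with natural numbers only, membership
    in an explicit list of neighbours becomes a matching of disjuncts. *)
Lemma adjacentE v w : adjacent v w =
  [|| [&& ca w == (ca v).+1, (cb w).+1 == cb v & cc w == cc v],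
      [&& (ca w).+1 == ca v, cb w == (cb v).+1 & cc w == cc v],
      [&& ca w == ca v, cb w == (cb v).+1 & (cc w).+1 == cc v],
      [&& ca w == ca v, (cb w).+1 == cb v & cc w == (cc v).+1],
      [&& (ca w).+1 == ca v, cb w == cb v & cc w == (cc v).+1] |
      [&& ca w == (ca v).+1, cb w == cb v & (cc w).+1 == cc v]].
Proof.
rewrite /adjacent !in_cons !in_nil !xpair_eqE.
move: (ca v) (cb v) (cc v) (ca w) (cb w) (cc w) => a b c a' b' c'.
have up (i j : nat) : (j%:Z - i%:Z == 1) = (j == i.+1) by lia.
have down (i j : nat) : (j%:Z - i%:Z == -1) = (j.+1 == i) by lia.
have same (i j : nat) : (j%:Z - i%:Z == 0) = (j == i) by lia.
by rewrite !up !down !same orbF -!andbA.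
Qed.

(** One family for the two kinds of observables that matter: the coordinates (for
    [e = 0]), which the walk preserves in the mean, and the squared length (for
    [e = 1]), which measures the time spent away from the corners. *)
Definition quadratic (p q r e : R) v : R :=
  p * (ca v)%:R + q * (cb v)%:R + r * (cc v)%:R
  + e * ((ca v)%:R ^+ 2 + (cb v)%:R ^+ 2 + (cc v)%:R ^+ 2).

(** Away from the corners the displacements come in opposite pairs, so the linear
    part has no drift, and each has squared length [1 + 1 + 0 = 2]; this holds in the
    interior and along the edges alike. *)
Lemma step_moments v (p q r e : R) :
  \sum_w step R v w * quadratic p q r e w
  = quadratic p q r e v + 2 * e * (~~ corner v)%:R.
Proof.
set f := quadratic p q r e; have [cv|ncv] := boolP (corner v).
  rewrite (@step_sum_uniform _ 1 [:: v]) ?big_seq1 //; first by rewrite /=; lra.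
  by move=> w; rewrite /step cv inE divr1.
have sv := coord_sum v; move: (ncv); rewrite corner_coords => ncv'.
have eq_pred (i j : nat) : (0 < j)%N -> (i == j.-1) = (i.+1 == j) by lia.
have pos_cases : [|| interior_vertex v, [&& cc v == 0, 0 < ca v & 0 < cb v]%N,
    [&& ca v == 0, 0 < cb v & 0 < cc v]%N | [&& cb v == 0, 0 < cc v & 0 < ca v]%N].
  rewrite /interior_vertex; lia.
have [iv|niv] := boolP (interior_vertex v).
  case/and3P: (iv) => a0 b0 c0; have [[ea eb] ec] := (prednK a0, prednK b0, prednK c0).
  (* The neighbours are listed in the order of the disjuncts of [adjacentE]. *)
  have [|w1 [a1 b1 c1]] := @tvertex_of_coords (ca v).+1 (cb v).-1 (cc v); first by lia.
  have [|w2 [a2 b2 c2]] := @tvertex_of_coords (ca v).-1 (cb v).+1 (cc v); first by lia.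
  have [|w3 [a3 b3 c3]] := @tvertex_of_coords (ca v) (cb v).+1 (cc v).-1; first by lia.
  have [|w4 [a4 b4 c4]] := @tvertex_of_coords (ca v) (cb v).-1 (cc v).+1; first by lia.
  have [|w5 [a5 b5 c5]] := @tvertex_of_coords (ca v).-1 (cb v) (cc v).+1; first by lia.
  have [|w6 [a6 b6 c6]] := @tvertex_of_coords (ca v).+1 (cb v) (cc v).-1; first by lia.
  rewrite (@step_sum_uniform _ 6 [:: w1; w2; w3; w4; w5; w6]).
  - rewrite !big_cons big_nil /f /quadratic a1 b1 c1 a2 b2 c2 a3 b3 c3 a4 b4 c4 a5 b5 c5 a6 b6 c6.
    rewrite -ea -eb -ec /= !mulrSr. by field.
  - rewrite !cons_uniq !in_cons !in_nil !tvertexE a1 b1 c1 a2 b2 c2 a3 b3 c3 a4 b4 c4 a5 b5 c5 a6 b6 c6 /=; lia.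
  - move=> w; rewrite /step (negPf ncv) iv; congr (_%:R / 6); congr nat_of_bool.
    rewrite adjacentE !in_cons in_nil orbF !tvertexE.
    rewrite a1 b1 c1 a2 b2 c2 a3 b3 c3 a4 b4 c4 a5 b5 c5 a6 b6 c6.
    by rewrite !eq_pred.
have edge w1 w2 : w1 != w2 ->
    (forall w, (w == w1) || (w == w2) = adjacent v w && same_edge v w) ->
    \sum_w step R v w * f w = (f w1 + f w2) / 2.
  move=> w12 ww; rewrite (@step_sum_uniform _ 2 [:: w1; w2]) ?big_cons ?big_nil ?addr0 //.
    by rewrite /= inE w12.
  by move=> w; rewrite /step (negPf ncv) (negPf niv) !inE ww.
(* On an edge, [same_edge] leaves only the pair of neighbours along that edge:
   every other candidate changes the vanishing coordinate. *)
case/or4P: pos_cases => [/(negP niv)//|||] /and3P[/eqP e0 p1 p2];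
  have [e1 e2] := (prednK p1, prednK p2).
- have [|w1 [a1 b1 c1]] := @tvertex_of_coords (ca v).+1 (cb v).-1 (cc v); first by lia.
  have [|w2 [a2 b2 c2]] := @tvertex_of_coords (ca v).-1 (cb v).+1 (cc v); first by lia.
  rewrite (edge w1 w2) /f /quadratic.
  + rewrite a1 b1 c1 a2 b2 c2 -e1 -e2 e0 /= !mulrSr; by field.
  + rewrite tvertexE a1 b1 c1 a2 b2 c2; lia.
  + move=> w; rewrite adjacentE /same_edge !tvertexE a1 b1 c1 a2 b2 c2 !eq_pred // e0.
    rewrite (gtn_eqF p1) (gtn_eqF p2) /=.
    by case: (cc w) => [|k]; rewrite /= ?andbF ?andbT ?orbF.
- have [|w1 [a1 b1 c1]] := @tvertex_of_coords (ca v) (cb v).+1 (cc v).-1; first by lia.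
  have [|w2 [a2 b2 c2]] := @tvertex_of_coords (ca v) (cb v).-1 (cc v).+1; first by lia.
  rewrite (edge w1 w2) /f /quadratic.
  + rewrite a1 b1 c1 a2 b2 c2 -e1 -e2 e0 /= !mulrSr; by field.
  + rewrite tvertexE a1 b1 c1 a2 b2 c2; lia.
  + move=> w; rewrite adjacentE /same_edge !tvertexE a1 b1 c1 a2 b2 c2 !eq_pred // e0.
    rewrite (gtn_eqF p1) (gtn_eqF p2) /=.
    by case: (ca w) => [|k]; rewrite /= ?andbF ?andbT ?orbF.
- have [|w1 [a1 b1 c1]] := @tvertex_of_coords (ca v).-1 (cb v) (cc v).+1; first by lia.
  have [|w2 [a2 b2 c2]] := @tvertex_of_coords (ca v).+1 (cb v) (cc v).-1; first by lia.
  rewrite (edge w1 w2) /f /quadratic.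
  + rewrite a1 b1 c1 a2 b2 c2 -e1 -e2 e0 /= !mulrSr; by field.
  + rewrite tvertexE a1 b1 c1 a2 b2 c2; lia.
  + move=> w; rewrite adjacentE /same_edge !tvertexE a1 b1 c1 a2 b2 c2 !eq_pred // e0.
    rewrite (gtn_eqF p1) (gtn_eqF p2) /=.
    by case: (cb w) => [|k]; rewrite /= ?andbF ?andbT ?orbF.
Qed.

End Step.
Arguments quadratic {R n}.

(** * Events of a variable with finitely many values *)

Section DiscreteVariable.
Context (d : measure_display) (T : measurableType d) (R : realType).
Context (Pr : probability T R) (I : finType) (Y : T -> I).
Context (mY : forall v, measurable [set om | Y om = v]).

Lemma measurable_discrete (Q : set I) : measurable [set om | Q (Y om)].
Proof.
have -> : [set om | Q (Y om)] = \bigcup_(v in Q) [set om | Y om = v].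
  by apply/seteqP; split=> [om Qom|om [v Qv /= ->]//]; exists (Y om).
by apply: fin_bigcup_measurable => // ; exact: finite_finset.
Qed.

Lemma probability_split (S : set T) : measurable S ->
  Pr S = (\sum_v Pr (S `&` [set om | Y om = v]))%E.
Proof.
move=> mS; rewrite fsbig_seq ?index_enum_uniq //.
rewrite -measure_fin_bigcup.
- congr (Pr _); apply/seteqP; split=> [om Som|om [v _ []//]].
  by exists (Y om); rewrite //= mem_index_enum.
- exact: finite_finset.
- by move=> v w _ _ [om [[_ /= <-] [_ /= <-]]].
- by move=> v _; exact: measurableI.
Qed.

End DiscreteVariable.

(** * The law of the walk *)

Section Walk.
Context (d : measure_display) (T : measurableType d) (R : realType).
Context (Pr : probability T R) (n : nat) (X : nat -> T -> tvertex n).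
Context (P : tvertex n) (hX : is_walk Pr X P).

Let mX t v : measurable [set om | X t om = v].
Proof. by case: hX. Qed.

Definition path_window (k t : nat) (x : nat -> tvertex n) : set T :=
  [set om | forall s, (k <= s <= t)%N -> X s om = x s].

Lemma measurable_path_window k t x : measurable (path_window k t x).
Proof.
have -> : path_window k t x =
    \bigcap_(s in [set s | (k <= s <= t)%N]) [set om | X s om = x s] by [].
by apply: bigcap_measurableType => s _; exact: mX.
Qed.

(** The Markov property survives forgetting the beginning of the history: split
    the event over the value at the forgotten time and sum, the factor [step]
    being the same in every term. *)
Lemma window_markov (k t : nat) (x : nat -> tvertex n) : (k <= t)%N ->
  (Pr (path_window k t.+1 x) =
   Pr (path_window k t x) * (step R (x t) (x t.+1))%:E)%E.
Proof.
elim: k x => [|k IH] x kt; first by case: hX => _ _ /(_ t x).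
pose upd v s := if s == k then v else x s.
have split_window u : (k <= u)%N -> Pr (path_window k.+1 u x) =
    (\sum_v Pr (path_window k u (upd v)))%E.
  move=> ku; rewrite (probability_split Pr (mX k)) //; last first.
    exact: measurable_path_window.
  apply: eq_bigr => v _; congr (Pr _).
  apply/seteqP; split=> om /=.
    move=> [wom Xk] s /andP[ks su]; rewrite /upd; case: eqP => [->//|/eqP sk].
    by apply: wom; rewrite su andbT ltn_neqAle eq_sym sk.
  move=> wom; split=> [s /andP[ks su]|].
    by rewrite wom ?(ltnW ks) // /upd gtn_eqF.
  by rewrite wom ?leqnn //= /upd eqxx.
rewrite !split_window ?(ltnW kt) ?(leqW (ltnW kt)) //.
rewrite ge0_sume_distrl //; apply: eq_bigr => v _.
by rewrite IH ?(ltnW kt) // /upd !gtn_eqF // ltnW.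
Qed.

Definition law t v : R := fine (Pr [set om | X t om = v]).

Lemma law_ge0 t v : 0 <= law t v.
Proof. exact: fine_ge0. Qed.

Lemma lawE t v : Pr [set om | X t om = v] = (law t v)%:E.
Proof. by rewrite fineK // fin_num_measure. Qed.

Lemma joint_law t v w :
  Pr ([set om | X t om = v] `&` [set om | X t.+1 om = w])
    = (law t v * step R v w)%:E.
Proof.
pose x s := if s == t then v else w.
have := @window_markov t t x (leqnn t).
rewrite /x eqxx gtn_eqF // EFinM -lawE => e.
transitivity (Pr (path_window t t.+1 x)).
  congr (Pr _); apply/seteqP; split=> om /=.
    move=> [Xv Xw] s /andP[ts st]; rewrite /x.
    case: eqP => [->//|/eqP st']; suff -> : s = t.+1 by [].
    by apply/eqP; rewrite eqn_leq st /= ltn_neqAle eq_sym st'.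
  move=> wom; split.
    by rewrite wom ?leqnn ?leqnSn // /x eqxx.
  by rewrite wom ?leqnn ?leqnSn // /x gtn_eqF.
rewrite e; congr (Pr _ * _)%E; apply/seteqP; split=> om /=.
  by move=> wom; rewrite wom ?leqnn // /x eqxx.
by move=> Xv s; rewrite -eqn_leq /x eq_sym => /eqP ->; rewrite eqxx.
Qed.

Definition mean t (f : tvertex n -> R) : R := \sum_v law t v * f v.

Lemma law_next t w : law t.+1 w = \sum_v law t v * step R v w.
Proof.
apply: EFin_inj; rewrite -lawE (probability_split Pr (mX t)) // -sumEFin.
by apply: eq_bigr => v _; rewrite setIC joint_law.
Qed.

Lemma mean_next t f : mean t.+1 f = mean t (fun v => \sum_w step R v w * f w).
Proof.
rewrite /mean; under eq_bigr do rewrite law_next mulr_suml.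
rewrite exchange_big /=; apply: eq_bigr => v _.
by rewrite mulr_sumr; apply: eq_bigr => w _; rewrite mulrA.
Qed.

Lemma law_total t : \sum_v law t v = 1.
Proof.
apply: EFin_inj; rewrite -sumEFin -(probability_setT Pr).
rewrite (probability_split Pr (mX t)) //.
by apply: eq_bigr => v _; rewrite setTI lawE.
Qed.

Lemma mean_le t f g : (forall v, f v <= g v) -> mean t f <= mean t g.
Proof. by move=> fg; apply: ler_sum => v _; rewrite ler_wpM2l ?law_ge0. Qed.

Lemma mean_start f : mean 0 f = f P.
Proof.
have l1 : law 0 P = 1 by case: hX => _ p1 _; rewrite /law p1.
have := law_total 0; rewrite (bigD1 P) //= l1 -[RHS]addr0 => /addrI l0.
have lv v : v != P -> law 0 v = 0.
  by move=> vP; apply: (psumr_eq0P _ l0) => // w _; exact: law_ge0.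
rewrite /mean (bigD1 P) //= l1 mul1r big1 ?addr0 // => v vP.
by rewrite lv ?mul0r.
Qed.

(** * Absorption at the corners *)

Definition alive t : R := mean t (fun v => (~~ corner v)%:R).

(** Summed over time, the drift of the squared length counts the expected number
    of steps before absorption. *)
Lemma mean_moments t (p q r e : R) :
  mean t (quadratic p q r e)
  = quadratic p q r e P + 2 * e * \sum_(s < t) alive s.
Proof.
elim: t => [|t IH]; first by rewrite mean_start big_ord0 mulr0 addr0.
rewrite mean_next /mean; under eq_bigr do rewrite step_moments mulrDr.
rewrite big_split /= -/(mean _ _) IH big_ord_recr /= mulrDr addrA.
congr (_ + _); rewrite mulr_sumr; apply: eq_bigr => v _.
by rewrite mulrCA.
Qed.

(** If [alive] stayed above [eps], the mean squared length would grow linearly in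
    time, whereas it is at most [(a + b + c)^2 = n^2]. *)
Lemma absorption (eps : R) : 0 < eps -> exists t, alive t < eps.
Proof.
move=> eps0; apply: contrapT => never.
have ge t : eps <= alive t.
  by rewrite leNgt; apply/negP => lt; apply: never; exists t.
pose t := Num.bound (n%:R ^+ 2 / eps : R).
have bound : n%:R ^+ 2 / eps < t%:R :> R.
  by apply: archi_boundP; rewrite divr_ge0 // ?exprn_ge0 // ltW.
have := mean_moments t 0 0 0 1; apply/eqP; rewrite lt_eqF //.
have sq (v : tvertex n) : quadratic 0 0 0 1 v <= n%:R ^+ 2 :> R.
  rewrite /quadratic !mul0r !add0r mul1r -!natrX -!natrD ler_nat.
  have := coord_sum v; nia.
have : mean t (quadratic 0 0 0 1) <= n%:R ^+ 2.
  apply: le_trans (mean_le t sq) _.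
  by rewrite /mean -mulr_suml law_total mul1r.
move=> /le_lt_trans; apply.
have : 0 <= quadratic 0 0 0 1 P :> R.
  by rewrite /quadratic !mul0r !add0r mul1r !addr_ge0 // exprn_ge0.
have : t%:R * eps <= \sum_(s < t) alive s.
  rewrite -[t in leLHS]card_ord mulr_natl -sumr_const.
  by apply: ler_sum => s _; exact: ge.
move: bound; rewrite ltr_pdivrMr //.
have : 0 <= t%:R * eps by rewrite mulr_ge0 // ltW.
lra.
Qed.

(** At a corner [step] gives no mass to other vertices, and there are countably many
    times and finitely many pairs of vertices. *)
Lemma escape_negligible :
  Pr.-negligible (\bigcup_t [set om | corner (X t om) /\ X t.+1 om <> X t om]).
Proof.
apply: negligible_bigcup => t; set S := [set om | _].
pose Y om := (X t om, X t.+1 om).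
have mY v : measurable [set om | Y om = v].
  have -> : [set om | Y om = v] =
      [set om | X t om = v.1] `&` [set om | X t.+1 om = v.2].
    by case: v => v w; apply/seteqP; split=> om /= [<- <-].
  exact: measurableI.
have mS : measurable S.
  exact: (measurable_discrete mY [set v | corner v.1 /\ v.2 <> v.1]).
suff S0 : Pr S = 0%E by exact/negligibleP.
rewrite (probability_split Pr mY) // big1 // => -[v w] _.
have [[cv wv]|nvw] := pselect (corner v /\ w <> v); last first.
  rewrite [X in Pr X](_ : _ = set0) ?measure0 //.
  apply/seteqP; split=> om //= -[[cX nX] [eX eX']].
  by apply: nvw; rewrite -eX -eX'.
rewrite [X in Pr X](_ : _ = [set om | X t om = v] `&` [set om | X t.+1 om = w]).
  by rewrite joint_law /step cv; move/eqP/negPf: wv => ->; rewrite mulr0.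
apply/seteqP; split=> om /=; first by move=> [_ [<- <-]].
by move=> [Xv Xw]; rewrite /S /Y /= Xv Xw.
Qed.

(** * The first corner reached *)

Lemma measurable_reaches_first k : measurable (reaches_first X k).
Proof.
have -> : reaches_first X k = \bigcup_t ([set om | X t om = k] `&`
    \bigcap_(s in [set s | (s < t)%N]) [set om | corner (X s om) -> X s om = k]).
  apply/seteqP; split=> om.
    by move=> [t [Xt before]]; exists t.
  by move=> [t _ [Xt before]]; exists t.
apply: bigcup_measurable => t _; apply: measurableI => //.
apply: bigcap_measurableType => s _.
exact: (measurable_discrete (mX s) [set v | corner v -> v = k]).
Qed.

(** Outside the null event of leaving a corner, a corner visited before time [t]
    is still occupied at time [t], hence equals [k]. *)
Lemma law_le_reach t k : law t k <= fine (Pr (reaches_first X k)).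
Proof.
have mr := measurable_reaches_first k.
rewrite -lee_fin -lawE fineK ?fin_num_measure //.
have [N [mN N0 escN]] := escape_negligible.
apply: (@le_trans _ _ (Pr (reaches_first X k `|` N))); last first.
  by rewrite -[leRHS]adde0 -N0; exact: measureU2.
apply: le_measure; rewrite ?inE //; first exact: measurableU.
move=> om /= Xt; have [Nom|nNom] := pselect (N om); [by right|left].
have stay s : corner (X s om) -> X s.+1 om = X s om.
  by move=> cs; apply: contrapT => ne; apply: nNom; apply: escN; exists s.
exists t; split=> // s st cs; rewrite -Xt -(subnKC (ltnW st)).
elim: (t - s)%N => [|m IH]; first by rewrite addn0.
by rewrite addnS stay -IH.
Qed.

(** The mean of a linear observable never changes.  If it is bounded by the indicator
    of [k] plus that of being unabsorbed, its initial value is at most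
    [law t k + alive t], and [alive t] can be made arbitrarily small. *)
Lemma reach_ge (k : tvertex n) (p q r : R) :
  (forall v, quadratic p q r 0 v <= (v == k)%:R + (~~ corner v)%:R) ->
  quadratic p q r 0 P <= fine (Pr (reaches_first X k)).
Proof.
move=> dom; apply/ler_addgt0Pr => eps /absorption[t lt].
have := mean_moments t p q r 0; rewrite mulr0 mul0r addr0 => <-.
apply: le_trans (mean_le t dom) _.
rewrite /mean; under eq_bigr do rewrite mulrDr.
rewrite big_split /= lerD ?(ltW lt) //; apply: le_trans (law_le_reach t k).
rewrite (bigD1 k) //= eqxx mulr1 big1 ?addr0 // => v /negPf ->.
by rewrite mulr0.
Qed.

Lemma reaches_first_disjoint k l : corner k -> corner l -> k <> l ->
  reaches_first X k `&` reaches_first X l = set0.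
Proof.
move=> ck cl kl; apply/seteqP; split=> om //= -[[t [Xt bt]] [s [Xs bs]]].
case: (ltngtP t s) => [ts|st|ts].
- by apply: kl; rewrite -Xt; apply: bs => //; rewrite Xt.
- by apply: kl; rewrite -Xs; apply/esym; apply: bt => //; rewrite Xs.
- by apply: kl; rewrite -Xt -Xs ts.
Qed.

(** Three lower bounds with sum [1] for the probabilities of three disjoint events
    must be attained. *)
Lemma reach_probabilities : (0 < n)%N ->
  game_evaluation Pr X = (((ca P)%:R / n%:R)%:E, ((cb P)%:R / n%:R)%:E,
                          ((cc P)%:R / n%:R)%:E).
Proof.
move=> n0; have n0' : 0 < n%:R :> R by rewrite ltr0n.
have fineE k : Pr (reaches_first X k) = (fine (Pr (reaches_first X k)))%:E.
  by rewrite fineK // fin_num_measure //; exact: measurable_reaches_first.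
have bound k (g : tvertex n -> nat) : g k = n -> 
    (forall v, corner v -> v != k -> g v = 0%N) -> (forall v, g v <= n)%N ->
    forall v, n%:R^-1 * (g v)%:R <= (v == k)%:R + (~~ corner v)%:R :> R.
  move=> gk g0 gn v; rewrite mulrC ler_pdivrMr // -natrD -natrM ler_nat.
  have [->|vk] := eqVneq v k; first by rewrite gk mulnDl mul1n leq_addr.
  have [cv|ncv] := boolP (corner v); first by rewrite g0.
  by rewrite /= add0n mul1n gn.
have [A0 B0 C0] : [/\ forall v, corner v -> v != cornerA n -> ca v = 0%N,
    forall v, corner v -> v != cornerB n -> cb v = 0%N &
    forall v, corner v -> v != cornerC n -> cc v = 0%N].
  by split=> v; rewrite /corner !inE => /or3P[]/eqP-> //; rewrite eqxx.
have [gA gB gC] : [/\ forall v : tvertex n, ca v <= n, forall v : tvertex n, cb v <= n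
    & forall v : tvertex n, cc v <= n]%N.
  by split=> v; have := coord_sum v; lia.
have qA v : quadratic n%:R^-1 0 0 0 v = n%:R^-1 * (ca v)%:R :> R.
  by rewrite /quadratic; ring.
have qB v : quadratic 0 n%:R^-1 0 0 v = n%:R^-1 * (cb v)%:R :> R.
  by rewrite /quadratic; ring.
have qC v : quadratic 0 0 n%:R^-1 0 v = n%:R^-1 * (cc v)%:R :> R.
  by rewrite /quadratic; ring.
have A1 : n%:R^-1 * (ca P)%:R <= fine (Pr (reaches_first X (cornerA n))).
  by rewrite -qA; apply: reach_ge => v; rewrite qA; exact: bound.
have B1 : n%:R^-1 * (cb P)%:R <= fine (Pr (reaches_first X (cornerB n))).
  by rewrite -qB; apply: reach_ge => v; rewrite qB; exact: bound.
have C1 : n%:R^-1 * (cc P)%:R <= fine (Pr (reaches_first X (cornerC n))).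
  by rewrite -qC; apply: reach_ge => v; rewrite qC; exact: bound.
have total : n%:R^-1 * (ca P)%:R + n%:R^-1 * (cb P)%:R + n%:R^-1 * (cc P)%:R = 1 :> R.
  by rewrite -!mulrDr -!natrD coord_sum mulVf ?gt_eqF.
have [cA cB cC] : [/\ corner (cornerA n), corner (cornerB n) & corner (cornerC n)].
  by rewrite /corner !inE !eqxx !orbT.
have [AB AC BC] : [/\ cornerA n <> cornerB n, cornerA n <> cornerC n
    & cornerB n <> cornerC n].
  split=> e; have := congr1 (@ca n) e; have := congr1 (@cb n) e;
    rewrite /ca /cb /=; lia.
have atmost : fine (Pr (reaches_first X (cornerA n))) +
    fine (Pr (reaches_first X (cornerB n))) +
    fine (Pr (reaches_first X (cornerC n))) <= 1.
  have mr := measurable_reaches_first.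
  have AB0 := reaches_first_disjoint cA cB AB.
  have ABC0 : (reaches_first X (cornerA n) `|` reaches_first X (cornerB n))
      `&` reaches_first X (cornerC n) = set0.
    by rewrite setIUl !reaches_first_disjoint ?setU0.
  rewrite -lee_fin !EFinD -!fineE -measureU // -measureU //.
    by apply: probability_le1; do 2! apply: measurableU => //.
  exact: measurableU.
have squeeze (a b c a' b' c' : R) : a <= a' -> b <= b' -> c <= c' ->
    a + b + c = 1 -> a' + b' + c' <= 1 -> [/\ a' = a, b' = b & c' = c].
  by move=> *; split; lra.
have [eA eB eC] := squeeze _ _ _ _ _ _ A1 B1 C1 total atmost.
rewrite /game_evaluation (fineE (cornerA n)) (fineE (cornerB n)) (fineE (cornerC n)).
by rewrite eA eB eC ![n%:R^-1 * _]mulrC.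
Qed.
End Walk.

(** * Barycentric coordinates in an equilateral triangle *)

Lemma edist_eq (R : realType) (p q p' q' : 'rV[R]_2) : edist p q = edist p' q' ->
  \sum_(i < 2) (p 0 i - q 0 i) ^+ 2 = \sum_(i < 2) (p' 0 i - q' 0 i) ^+ 2.
Proof.
have ge0 (u v : 'rV[R]_2) : 0 <= \sum_(i < 2) (u 0 i - v 0 i) ^+ 2.
  by apply: sumr_ge0 => i _; exact: sqr_ge0.
by move=> /eqP; rewrite eqr_sqrt // => /eqP.
Qed.

(** With [u = A - C], [v = B - C] and common squared side length [S], the inner
    products are [u.u = v.v = S] and [u.v = S / 2].  Pairing a relation
    [a u + b v = 0] with [u] and with [v] gives a system in [a], [b] of determinant
    [3 S^2 / 4], which is nonzero. *)
Lemma equilateral_barycentric_unique (R : realType) (A B C p : 'rV[R]_2)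
    (x y z x' y' z' : R) :
  equilateral A B C -> barycentric A B C p x y z -> barycentric A B C p x' y' z' ->
  [/\ x = x', y = y' & z = z'].
Proof.
move=> [AB /edist_eq eAB /edist_eq eBC] [s ->] [s' e].
have coords i : (x - x') * (A 0 i - C 0 i) + (y - y') * (B 0 i - C 0 i) = 0.
  have := congr1 (fun M : 'rV[R]_2 => M 0 i) e; rewrite !mxE.
  have -> : z = 1 - x - y by lra.
  have -> : z' = 1 - x' - y' by lra.
  lra.
have apart : 0 < \sum_(i < 2) (B 0 i - C 0 i) ^+ 2.
  rewrite lt_def sumr_ge0 ?andbT; last by move=> i _; exact: sqr_ge0.
  apply/eqP => s0; apply: AB; apply/rowP => i; apply/eqP; rewrite -subr_eq0.
  rewrite -sqrf_eq0; apply/eqP; move: eAB; rewrite s0 => /psumr_eq0P -> // j _.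
  exact: sqr_ge0.
move: eAB eBC apart (coords 0) (coords 1).
rewrite !big_ord_recr !big_ord0 /= !add0r.
set i0 := widen_ord _ _; set i1 := ord_max.
have -> : (0 : 'I_2) = i0 by apply/val_inj.
have -> : (1 : 'I_2) = i1 by apply/val_inj.
set a := x - x'; set b := y - y'.
move: (A 0 i0) (A 0 i1) (B 0 i0) (B 0 i1) (C 0 i0) (C 0 i1) => A0 A1 B0 B1 C0 C1.
set S := (B0 - C0) ^+ 2 + _ => eAB eBC S0 e0 e1.
pose u0 := A0 - C0; pose u1 := A1 - C1; pose v0 := B0 - C0; pose v1 := B1 - C1.
have uu : u0 * u0 + u1 * u1 = S by rewrite eBC /u0 /u1; ring.
have vv : v0 * v0 + v1 * v1 = S by rewrite /S /v0 /v1; ring.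
have uv : u0 * v0 + u1 * v1 = S / 2.
  have : (u0 - v0) * (u0 - v0) + (u1 - v1) * (u1 - v1) = S.
    by rewrite -eAB /u0 /u1 /v0 /v1; ring.
  lra.
have eu : a * S + b * (S / 2) = 0.
  transitivity (u0 * (a * u0 + b * v0) + u1 * (a * u1 + b * v1)).
    by rewrite -uv -uu; ring.
  by rewrite e0 e1 !mulr0 addr0.
have ev : a * (S / 2) + b * S = 0.
  transitivity (v0 * (a * u0 + b * v0) + v1 * (a * u1 + b * v1)).
    by rewrite -uv -vv; ring.
  by rewrite e0 e1 !mulr0 addr0.
have aS : a * S = 0 by lra.
have bS : b * S = 0 by lra.
have a0 : a = 0 by apply/eqP; move/eqP: aS; rewrite mulf_eq0 (gt_eqF S0) orbF.
have b0 : b = 0 by apply/eqP; move/eqP: bS; rewrite mulf_eq0 (gt_eqF S0) orbF.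
have ex : x = x' by apply/eqP; rewrite -subr_eq0 -/a a0.
have ey : y = y' by apply/eqP; rewrite -subr_eq0 -/b b0.
by split=> //; lra.
Qed.

Theorem theorem4p1 (R : realType) (A B C : 'rV[R]_2) (hABC : equilateral A B C)
    (n : nat) (hn : (1 <= n)%N) (P : tvertex n) (x y z : R)
    (hP : barycentric A B C (pos A B C P) x y z)
    (d : measure_display) (T : measurableType d) (Pr : probability T R)
    (X : nat -> T -> tvertex n) (hX : is_walk Pr X P) :
  game_evaluation Pr X = (x%:E, y%:E, z%:E).
Proof.
have hP' : barycentric A B C (pos A B C P)
    ((ca P)%:R / n%:R) ((cb P)%:R / n%:R) ((cc P)%:R / n%:R).
  split=> //; rewrite -!mulrDl -!natrD coord_sum divff // pnatr_eq0.
  by rewrite -lt0n.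
by have [-> -> ->] := equilateral_barycentric_unique hABC hP hP'; exact: reach_probabilities.
Qed.
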